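(* Let $G$ be a $2$-connected convex bipartite graph. Then $G$ has a Hamiltonian cycle if and only if for every $S\subseteq V(G)$, $c(G-S)\le |S|$, where $c(G-S)$ denotes the number of connected components of $G-S$.
   Context: All graphs are finite and simple. A convex bipartite graph is a bipartite graph $G$ with bipartition $(X,Y)$ together with an ordering $X=(x_1,\ldots,x_n)$ such that for every $y\in Y$ the neighborhood $N_G(y)$ consists of consecutive vertices of this ordering.
   Formalization: The condition c(G-S) ≤ |S| is required only for nonempty S ⊆ V(G), since for S empty it would read 1 ≤ 0 and fail for every 2-connected G, for instance the Hamiltonian 4-cycle. *)

(* Defs.v *)
From mathcomp Require Import all_boot.

Set Implicit Arguments.
Unset Strict Implicit.
Unset Printing Implicit Defensive.

Definition simple_graph (T : finType) (e : rel T) : Prop :=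
  symmetric e /\ irreflexive e.

(** The subgraph induced on [A], as a relation on the whole type [T]; the
    vertices outside [A] become isolated, so the notions below only look at
    vertices in [A]. *)
Definition induced (T : finType) (e : rel T) (A : {set T}) : rel T :=
  [rel x y | [&& x \in A, y \in A & e x y]].

Definition connected_on (T : finType) (e : rel T) (A : {set T}) : Prop :=
  A != set0 /\ {in A &, forall x y, connect (induced e A) x y}.

(** c(G - S) *)
Definition ncomp_del (T : finType) (e : rel T) (S : {set T}) : nat :=
  n_comp (induced e (~: S)) (~: S).

(** The bound on the number of vertices excludes the complete graph on two
    vertices. *)
Definition two_connected (T : finType) (e : rel T) : Prop :=
  2 < #|T| /\ forall S : {set T}, #|S| < 2 -> connected_on e (~: S).

Definition neighborhood (T : finType) (e : rel T) (v : T) : {set T} :=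
  [set u | e v u].

Definition bipartition (T : finType) (e : rel T) (X Y : {set T}) : Prop :=
  [/\ X :|: Y = [set: T], [disjoint X & Y],
      {in X &, forall u v, ~~ e u v} & {in Y &, forall u v, ~~ e u v}].

(** [xs] lists the elements of [X] without repetition, and the neighborhood of
    each vertex of [Y] is the set of entries of a contiguous block of [xs]. *)
Definition convex_ordering
    (T : finType) (e : rel T) (X Y : {set T}) (xs : seq T) : Prop :=
  [/\ uniq xs, xs =i X &
      forall y, y \in Y -> exists2 s, infix s xs & s =i neighborhood e y].

Definition convex_bipartite
    (T : finType) (e : rel T) (X Y : {set T}) (xs : seq T) : Prop :=
  bipartition e X Y /\ convex_ordering e X Y xs.

(** [cycle] also accepts closed walks of length at most 2, which are not
    cycles of a simple graph; hence the bound on the size. *)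
Definition hamiltonian_cycle (T : finType) (e : rel T) (c : seq T) : Prop :=
  [/\ 2 < size c, cycle e c, uniq c & c =i T].

(* Main.v *)
Require Import Defs.
From mathcomp Require Import all_boot.

(** Toughness with S = X and with S = Y gives |X| = |Y| = n, and with S a
    proper block x_a, ..., x_(b-1) it gives that fewer than b - a vertices of Y
    have their whole neighborhood in the block.  These counts alone suffice.
    Grow a path covering x_0, ..., x_i whose ends are x_i and some x_j, j < i.
    To reach x_(i+1), take among the unused y whose neighborhood starts at or
    before x_i one whose neighborhood ends first; attach it to x_j if it sees
    x_j (the new ends being x_(i+1) and x_i), and to x_i otherwise.  The counts
    show, as for earliest-deadline-first scheduling, that no y expires unused,
    and that some unused y always sees x_j or something before it; at the end
    this is the only remaining y, and it closes the cycle. *)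

(** * Counting the components of [G - S], and necessity of the condition *)

Lemma induced_connect_sym {T : finType} {e : rel T} (A : {set T}) :
  symmetric e -> connect_sym (induced e A).
Proof.
move=> esym; apply: sym_connect_sym => x y.
by rewrite /induced /= esym andbCA.
Qed.

(** The map [root] is injective on [R], and its values there are among the representatives that
    [n_comp] counts. *)
Lemma card_leq_ncomp_del {T : finType} {e : rel T} (S R : {set T}) :
  symmetric e -> R \subset ~: S ->
  {in R &, forall x y, connect (induced e (~: S)) x y -> x = y} ->
  #|R| <= ncomp_del e S.
Proof.
move=> esym RS Rsep; have csym := induced_connect_sym (~: S) esym.
have rinj : {in R &, injective (root (induced e (~: S)))}.
  by move=> x y xR yR /eqP; rewrite root_connect // => /Rsep; apply.
rewrite -(card_in_imset rinj); apply/subset_leq_card/subsetP => _ /imsetP[x xR ->].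
have xS : x \in ~: S by apply: (subsetP RS).
(* Only roots inside [~: S] are counted, so the root of a vertex of [R] must not leave [~: S]. *)
have clS : closed (induced e (~: S)) (~: S).
  by move=> u v /and3P[-> ->].
apply/andP; split; first exact: roots_root.
by rewrite /= -(closed_connect clS (connect_root _ x)).
Qed.

Lemma connect_isolated {T : finType} {e : rel T} (S : {set T}) (x y : T) :
  neighborhood e x \subset S -> connect (induced e (~: S)) x y -> x = y.
Proof.
move=> /subsetP xS /connectP[[|z p] /= pth ->] //.
case/andP: pth => /and3P[_ zS exz] _.
by move: zS; rewrite inE xS // inE.
Qed.

Lemma card_isolated_leq_ncomp_del {T : finType} {e : rel T} (S B : {set T}) :
  symmetric e -> [disjoint B & S] ->
  {in B, forall x, neighborhood e x \subset S} ->
  #|B| <= ncomp_del e S.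
Proof.
move=> esym BS iso; apply: card_leq_ncomp_del => //.
  by rewrite -disjoints_subset.
by move=> x y xB _; apply: connect_isolated; apply: iso.
Qed.

(** The component of [v] comes on top of the singleton components of [B], which makes the bound
    strict. *)
Lemma card_isolated_lt_ncomp_del {T : finType} {e : rel T} (S B : {set T}) (v : T) :
  symmetric e -> [disjoint B & S] ->
  {in B, forall x, neighborhood e x \subset S} ->
  v \notin B -> v \notin S -> #|B| < ncomp_del e S.
Proof.
move=> esym BS iso vB vS.
have -> : #|B|.+1 = #|v |: B| by rewrite cardsU1 vB.
apply: card_leq_ncomp_del => //.
  by rewrite subUset sub1set inE vS -disjoints_subset.
have csym := induced_connect_sym (~: S) esym.
move=> x y /setU1P[->|xB] /setU1P[->|yB] // cxy.
- by symmetry; apply: (connect_isolated S); [exact: iso | rewrite csym].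
- by apply: (connect_isolated S) cxy; exact: iso.
- by apply: (connect_isolated S) cxy; exact: iso.
Qed.

(** Some vertex of each component of G - S is followed on the cycle by a vertex
    of S, as the component would otherwise be closed under [next c]. *)
Lemma hamiltonian_ncomp_del {T : finType} {e : rel T} (c : seq T) (S : {set T}) :
  symmetric e -> hamiltonian_cycle e c -> S != set0 -> ncomp_del e S <= #|S|.
Proof.
move=> esym [_ cyc uc call] /set0Pn[s0 s0S].
set r := induced e (~: S); have csym : connect_sym r by exact: induced_connect_sym.
(* The cycle predecessors of the vertices of [S] meet every component. *)
suff sub : [predI roots r & ~: S] \subset [set root r (prev c s) | s in S].
  exact: leq_trans (subset_leq_card sub) (leq_imset_card _ _).
apply/subsetP => x /andP[/eqP xroot xS].
have [v /andP[cxv vS]|stay] := pickP [pred v | connect r x v & next c v \in S].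
  apply/imsetP; exists (next c v) => //.
  by rewrite prev_next // -xroot; apply/eqP; rewrite root_connect.
have reach k : connect r x (iter k (next c) x) /\ iter k (next c) x \in ~: S.
  elim: k => //= k [cxk kS]; set z := iter k _ x in cxk kS *.
  have nS : next c z \in ~: S by have := stay z; rewrite /= cxk inE => /negbT.
  split=> //; apply: connect_trans cxk (connect1 _).
  by rewrite /r /induced /= kS nS next_cycle // call.
have cxs : fconnect (next c) x s0.
  by rewrite (fconnect_cycle (cycle_next uc)) call.
by have [_] := reach (findex (next c) x s0); rewrite iter_findex // inE s0S.
Qed.

(** * Growing the path by earliest deadline *)

(** With [l] as release time and [r] as deadline, these are the jobs confined to the time window
    [[a, b)]. *)
Definition within {T : finType} (l r : T -> nat) (Y : {set T}) (a b : nat) : {set T} :=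
  [set y in Y | (a <= l y) && (r y <= b)].

(** Otherwise all of [R] would lie in the smaller set [within l r Y i.+1 n]. This yields [pp_back]
    for the initial path and whenever [x_i] becomes the far end. *)
Lemma exists_early_start {T : finType} (l r : T -> nat) (Y R : {set T}) (i n : nat) :
  R \subset Y -> (forall y, y \in Y -> r y <= n) ->
  #|within l r Y i.+1 n| < #|R| -> exists2 y, y \in R & l y <= i.
Proof.
move=> RY rle; rewrite ltnNge => big.
have /subsetPn[y yR] : ~~ (R \subset within l r Y i.+1 n).
  by apply: contra big => /subset_leq_card.
rewrite inE (subsetP RY) // rle ?(subsetP RY) // andbT -ltnNge ltnS.
by exists y.
Qed.

(** [R] is the set of vertices of [Y] not on the path; the neighborhood of
    [y \in Y] is the half-open block of indices from [l y] to [r y]. *)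
Record partial_path {T : finType} (e : rel T) (x0 : T) (xs : seq T)
    (l r : T -> nat) (Y : {set T}) (i j : nat) (R : {set T}) (p : seq T) : Prop :=
  PartialPath {
    pp_path : path e (nth x0 xs i) p;
    pp_last : last (nth x0 xs i) p = nth x0 xs j;
    pp_uniq : uniq (nth x0 xs i :: p);
    pp_mem : forall v,
      (v \in nth x0 xs i :: p) = (v \in take i.+1 xs) || (v \in Y :\: R);
    pp_ends : (j < i) || (i == 0) && (j == 0);
    pp_sub : R \subset Y;
    pp_card : #|R| + i = size xs;
    pp_unused : forall y, y \in Y -> i <= l y -> y \in R;
    pp_deadline : forall b, i < b < size xs -> #|within l r R 0 b| < b - i;
    pp_back : exists2 y, y \in R & l y <= j;
    pp_alive : forall y, y \in R -> l y < i -> i < r y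
  }.

(** [pp_back] provides a vertex to use next, and [pp_deadline] ensures that it still sees [x_(i+1)];
    its minimal deadline together with [sparse] restores the invariant. *)
Lemma partial_path_step {T : finType} (e : rel T) (x0 : T) (xs : seq T)
    (l r : T -> nat) (Y : {set T}) (i j : nat) (R : {set T}) (p : seq T) :
  symmetric e -> uniq xs -> [disjoint xs & Y] ->
  (forall y k, y \in Y -> k < size xs -> e y (nth x0 xs k) = (l y <= k < r y)) ->
  (forall y, y \in Y -> r y <= size xs) ->
  (forall a b, a < b <= size xs -> b - a < size xs -> #|within l r Y a b| < b - a) ->
  i.+1 < size xs -> partial_path e x0 xs l r Y i j R p ->
  exists j' R' p', partial_path e x0 xs l r Y i.+1 j' R' p'.
Proof.
move=> esym uxs disj rep rle sparse lt_i [pth lst unq mem ends RY cardR unused dead back alive].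
have [y0 y0R y0j] := back.
have le_ji : j <= i by case/orP: ends => [/ltnW //|/andP[/eqP-> /eqP->]].
have y0i : l y0 <= i := leq_trans y0j le_ji.
have [y /andP[yR yi] ymin] := arg_minnP (P := [pred y | (y \in R) && (l y <= i)]) r
  (i0 := y0) (introT andP (conj y0R y0i)).
have yY : y \in Y := subsetP RY y yR.
have ry : i.+1 < r y.
  rewrite ltnNge; apply/negP => ryi.
  have : #|within l r R 0 i.+1| < i.+1 - i by apply: dead; rewrite ltnSn.
  rewrite subSnn ltnS leqn0 cards_eq0 => /eqP/setP/(_ y).
  by rewrite !inE yR ryi.
pose R' := R :\ y.
have cardR' : #|R'|.+1 = #|R| by rewrite (cardsD1 y R) yR.
have sub' : R' \subset Y by apply: subset_trans (subD1set _ _) RY.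
have card' : #|R'| + i.+1 = size xs by rewrite -cardR -cardR' addSnnS.
have unused' z : z \in Y -> i.+1 <= l z -> z \in R'.
  move=> zY zi; rewrite !inE unused ?andbT //; last exact: ltnW.
  by apply: contraTneq zi => ->; rewrite -ltnNge ltnS.
have dead' b : i.+1 < b < size xs -> #|within l r R' 0 b| < b - i.+1.
  (* If [y] expires by [b], its removal lowers the count by one, as much as the bound drops. *)
  case/andP=> ib bn; have [ryb|ryb] := leqP (r y) b.
    have := dead b; rewrite (ltnW ib) bn (cardsD1 y) inE yR ryb /= add1n.
    suff -> : within l r R 0 b :\ y = within l r R' 0 b.
      by move=> /(_ isT); rewrite subnS; case: (b - i).
    by apply/setP => z; rewrite !inE andbA.
  apply: leq_ltn_trans (sparse i.+1 b _ _); rewrite ?ib ?(ltnW bn) //; last first.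
    exact: leq_ltn_trans (leq_subr _ _) bn.
  apply/subset_leq_card/subsetP => z; rewrite !inE /= -andbA => /and3P[_ zR rz].
  rewrite (subsetP RY) // rz andbT /= ltnNge; apply/negP => zi.
  have := ymin z; rewrite /= zR zi => /(_ isT) /leq_trans /(_ rz).
  by rewrite leqNgt ryb.
have back' : exists2 z, z \in R' & l z <= i.
  apply: exists_early_start sub' rle _; apply: leq_trans (sparse _ _ _ _) _.
  - by rewrite lt_i leqnn.
  - by rewrite ltn_subrL (ltn_trans _ lt_i).
  - by rewrite -card' addnK.
have alive' z : z \in R' -> l z < i.+1 -> i.+1 < r z.
  rewrite !inE => /andP[_ zR] zi.
  by apply: leq_trans ry (ymin z _); rewrite /= zR -ltnS zi.
set x' := nth x0 xs i.+1; set q := nth x0 xs i :: p in unq mem *.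
have x'take : x' \notin take i.+1 xs.
  by rewrite in_take ?mem_nth // index_uniq // ltnn.
have x'Y : x' \notin Y by rewrite (disjointFr disj) // mem_nth.
have ytake : y \notin take i.+1 xs.
  by apply/negP => /mem_take yxs; rewrite (disjointFr disj yxs) in yY.
(* Stated for any rearrangement [s] of [q], since one of the two cases below reverses the path. *)
have grow_uniq s : uniq s -> s =i q -> uniq [:: x', y & s].
  move=> us sq; rewrite /= inE !sq !mem !inE us yR (negPf x'take) (negPf ytake).
  by rewrite (negPf x'Y) andbF !orbF !andbT; apply: contraNneq x'Y => ->.
have grow_mem s : s =i q -> forall v,
    (v \in [:: x', y & s]) = (v \in take i.+2 xs) || (v \in Y :\: R').
  move=> sq v; rewrite (take_nth x0) // mem_rcons !inE sq mem !inE -/x'.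
  by have [->|_] := eqVneq v y; rewrite ?yY /= ?orbT ?orbA.
have [yj|jy] := leqP (l y) j.
(* Here [y] links [x_(i+1)] to the far end [x_j], so the old path is run backwards and now ends at
   [x_i]. *)
- exists i, R', (y :: rev q); split=> //=.
  + rewrite esym rep // ry (leq_trans yi) //=.
    rewrite /q lastI rev_rcons lst /= rep //; last exact: leq_ltn_trans (ltnW lt_i).
    rewrite yj (leq_ltn_trans le_ji (ltnW ry)) /=.
    by rewrite -lst rev_path (eq_path (e' := e)).
  + by rewrite rev_cons last_rcons.
  + by apply: grow_uniq; [rewrite rev_uniq | exact: mem_rev].
  + by apply: grow_mem; exact: mem_rev.
  + by rewrite leqnn.
- exists j, R', (y :: q); split=> //=.
  + by rewrite esym !rep ?(ltnW lt_i) // ry yi (leq_trans yi) //= (ltnW ry).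
  + exact: grow_uniq.
  + exact: grow_mem.
  + by rewrite ltnS le_ji.
  + exists y0 => //; rewrite !inE y0R andbT.
    by apply: contraTneq jy => <-; rewrite -leqNgt.
Qed.

Lemma sparse_hamiltonian {T : finType} (e : rel T) (x0 : T) (xs : seq T)
    (l r : T -> nat) (Y : {set T}) :
  symmetric e -> 2 < #|T| -> uniq xs -> [disjoint xs & Y] ->
  (forall v, (v \in xs) || (v \in Y)) -> #|Y| = size xs -> 1 < size xs ->
  (forall y k, y \in Y -> k < size xs -> e y (nth x0 xs k) = (l y <= k < r y)) ->
  (forall y, y \in Y -> r y <= size xs) ->
  (forall a b, a < b <= size xs -> b - a < size xs -> #|within l r Y a b| < b - a) ->
  exists c, hamiltonian_cycle e c.
Proof.
move=> esym T2 uxs disj cover cardY n1 rep rle sparse.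
have n0 : 0 < size xs by apply: ltnW.
have main k : k < size xs ->
    exists j R p, partial_path e x0 xs l r Y k j R p.
  elim: k => [_|k IH lt_k]; last first.
    have [j [R [p]]] := IH (ltnW lt_k).
    exact: partial_path_step.
  exists 0, Y, [::]; split=> //=.
  - move=> v; rewrite setDv in_set0 orbF; case: (xs) n0 => //= x s _.
    by rewrite take0.
  - by rewrite addn0.
  (* The range [b < size xs] keeps the block proper: the full ordering confines all of [Y], as many
     vertices as its length. *)
  - move=> b /andP[b0 bn]; apply: sparse; last by rewrite subn0.
    by rewrite b0 ltnW.
  - apply: exists_early_start (subxx Y) rle _.
    rewrite cardY; apply: leq_trans (sparse _ _ _ _) (leq_subr 1 _).
      by rewrite n1 leqnn.
    by rewrite ltn_subrL n0.
have lt_m : (size xs).-1 < size xs by rewrite prednK.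
have [j [R [p [pth lst unq mem ends RY cardR _ _ [y yR yj] alive]]]] := main _ lt_m.
(* This rules out the one-vertex case of [pp_ends], so the two ends differ. *)
have m0 : 0 < (size xs).-1 by rewrite -ltnS prednK.
have lt_jm : j < (size xs).-1 by move: ends; rewrite (gtn_eqF m0) orbF.
have lym := leq_ltn_trans yj lt_jm.
have yY := subsetP RY y yR.
have rym := alive y yR lym.
have R1 : R = [set y].
  apply/eqP; rewrite eq_sym eqEcard sub1set yR cards1.
  by rewrite -(leq_add2r (size xs).-1) cardR add1n prednK /=.
have yxs : y \notin xs by apply/negP => yxs; rewrite (disjointFr disj yxs) in yY.
set q := nth x0 xs (size xs).-1 :: p in unq mem.
have takeE : take (size xs).-1.+1 xs = xs by rewrite prednK // take_size.
have call : y :: q =i T.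
  move=> v; rewrite in_cons mem takeE R1 !inE.
  by have [//|_] := eqVneq v y; exact: cover.
have uc : uniq (y :: q).
  by rewrite cons_uniq unq andbT mem takeE R1 !inE eqxx orbF.
exists (y :: q); split=> //.
- by rewrite -(card_uniqP uc) (eq_card call).
- have lt_j := ltn_trans lt_jm lt_m.
  rewrite /q /= rcons_path pth lst [e _ y]esym !rep //.
  by rewrite yj (ltn_trans lt_jm rym) (ltnW lym) rym.
Qed.

(** * From toughness and convexity to interval counts *)

Lemma connected_has_edge {T : finType} (e : rel T) :
  1 < #|T| -> connected_on e (~: set0) -> exists u v, e u v.
Proof.
move=> /card_gt1P[x [y [_ _ xy]]] [_ /(_ x y)].
rewrite !inE => /(_ isT isT) /connectP[[|z p] /=].
  by move=> _ yx; rewrite yx eqxx in xy.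
by case/andP=> /and3P[_ _ exz] _ _; exists x, z.
Qed.

Lemma mem_take_drop {T : eqType} (x0 : T) (xs : seq T) (a m k : nat) :
  uniq xs -> k < size xs ->
  (nth x0 xs k \in take m (drop a xs)) = (a <= k < a + m).
Proof.
move=> uxs lt_k; apply/(nthP x0)/andP => [[i]|[ak km]].
  rewrite size_take_min size_drop leq_min => /andP[im ia].
  rewrite nth_take // nth_drop => /eqP.
  rewrite nth_uniq // -?ltn_subRL // => /eqP <-.
  by rewrite leq_addr ltn_add2l.
exists (k - a); last by rewrite nth_take ?ltn_subLR // nth_drop subnKC.
by rewrite size_take_min size_drop leq_min ltn_sub2rE // andbC lt_k ltn_subLR.
Qed.

Lemma infix_interval {T : eqType} (x0 : T) (s xs : seq T) :
  uniq xs -> infix s xs ->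
  exists a b, b <= size xs /\
    forall k, k < size xs -> (nth x0 xs k \in s) = (a <= k < b).
Proof.
move=> uxs /infixP[p [q def_xs]]; exists (size p), (size p + size s); split.
  by rewrite def_xs !size_cat addnA leq_addr.
move=> k lt_k; rewrite -(mem_take_drop x0 xs) //.
by rewrite def_xs drop_size_cat // take_size_cat.
Qed.

(** Deleting [A] isolates every vertex of [B]. Applied both ways, this gives [|X| = |Y|]. *)
Lemma tough_card_leq {T : finType} {e : rel T} (A B : {set T}) :
  symmetric e -> bipartition e A B -> A != set0 ->
  (forall S : {set T}, S != set0 -> ncomp_del e S <= #|S|) -> #|B| <= #|A|.
Proof.
move=> esym [cover disj _ indepB] A0 tough; apply: leq_trans (tough A A0).
apply: card_isolated_leq_ncomp_del => //; first by rewrite disjoint_sym.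
move=> y yB; apply/subsetP => x; rewrite inE => eyx.
have := in_setT x; rewrite -cover inE => /orP[//|xB].
by have := indepB y x yB xB; rewrite eyx.
Qed.

(** Deleting the block isolates the vertices of [Y] confined to it, and a vertex of [X] outside the
    block, which exists because the block is proper, lies in one more component. *)
Lemma tough_sparse {T : finType} (e : rel T) (x0 : T) (xs : seq T)
    (l r : T -> nat) (X Y : {set T}) (a b : nat) :
  symmetric e -> bipartition e X Y -> uniq xs -> xs =i X ->
  (forall y k, y \in Y -> k < size xs -> e y (nth x0 xs k) = (l y <= k < r y)) ->
  (forall S : {set T}, S != set0 -> ncomp_del e S <= #|S|) ->
  a < b <= size xs -> b - a < size xs -> #|within l r Y a b| < b - a.
Proof.
move=> esym [cover disj _ indepY] uxs xsX rep tough /andP[ab bn] proper.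
pose s := take (b - a) (drop a xs); pose S := [set x in s].
have sxs x : x \in s -> x \in X by rewrite -xsX => /mem_take /mem_drop.
have us : uniq s by rewrite take_uniq // drop_uniq.
have size_s : size s = b - a by rewrite size_takel // size_drop leq_sub2r.
have mem_s k : k < size xs -> (nth x0 xs k \in s) = (a <= k < b).
  by move=> lt_k; rewrite mem_take_drop // subnKC // ltnW.
have cardS : #|S| = b - a by rewrite cardsE (card_uniqP us).
rewrite -cardS; have S0 : S != set0 by rewrite -card_gt0 cardS subn_gt0.
have disjS : [disjoint within l r Y a b & S].
  apply/pred0P => y /=; rewrite !inE; apply/negP => /andP[/andP[yY _] /sxs yX].
  by rewrite (disjointFr disj yX) in yY.
have [v vX vS] : exists2 v, v \in X & v \notin S.
  have /subsetPn[v vX vS] : ~~ (X \subset S); last by exists v.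
  apply/negP => /subset_leq_card; rewrite cardS -(eq_card xsX) (card_uniqP uxs).
  by rewrite leqNgt proper.
apply: leq_trans (tough S S0); apply: (card_isolated_lt_ncomp_del S _ v) => //.
  move=> y; rewrite inE => /and3P[yY ay yb]; apply/subsetP => x; rewrite !inE => eyx.
  have xX : x \in X.
    have := in_setT x; rewrite -cover inE => /orP[//|xY].
    by have := indepY y x yY xY; rewrite eyx.
  have [k lt_k def_x] : exists2 k, k < size xs & nth x0 xs k = x.
    by apply/nthP; rewrite xsX.
  move: eyx; rewrite -def_x rep // mem_s // => /andP[lk kr].
  by rewrite (leq_trans ay lk) (leq_trans kr yb).
by rewrite inE (disjointFr disj vX).
Qed.

(** The condition ranges over nonempty [S]: a connected graph has one component, so [S = set0] would
    demand [1 <= 0]. *)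
Theorem theorem6 (T : finType) (e : rel T) (X Y : {set T}) (xs : seq T)
    (hG : simple_graph e)
    (h2 : two_connected e)
    (hconv : convex_bipartite e X Y xs) :
  (exists c : seq T, hamiltonian_cycle e c) <->
  (forall S : {set T}, S != set0 -> ncomp_del e S <= #|S|).
Proof.
have [esym _] := hG; have [T2 conn] := h2.
split=> [[c hc] S S0|tough]; first exact: hamiltonian_ncomp_del hc S0.
have [bip [uxs xsX conv]] := hconv; have [cover disj indepX indepY] := bip.
have mem_XY v : (v \in X) || (v \in Y) by rewrite -in_setU cover inE.
(* An edge shows that both sides are nonempty, so toughness applies to each of them. *)
have edge : exists x y, [/\ x \in X, y \in Y & e x y].
  have [|u [v euv]] := connected_has_edge e (ltnW T2); first by apply: conn; rewrite cards0.
  have [uX|uX] := boolP (u \in X); have [vX|vX] := boolP (v \in X).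
  - by have := indepX u v uX vX; rewrite euv.
  - by exists u, v; split=> //; have := mem_XY v; rewrite (negPf vX).
  - by exists v, u; split; rewrite 1?esym //; have := mem_XY u; rewrite (negPf uX).
  - have := mem_XY u; have := mem_XY v; rewrite (negPf uX) (negPf vX) /= => vY uY.
    by have := indepY u v uY vY; rewrite euv.
have [x0 [y0 [x0X y0Y _]]] := edge.
have X0 : X != set0 by apply/set0Pn; exists x0.
have Y0 : Y != set0 by apply/set0Pn; exists y0.
have bip' : bipartition e Y X by split; rewrite // 1?setUC // disjoint_sym.
have cardX : #|X| = size xs by rewrite -(eq_card xsX) (card_uniqP uxs).
have cardY : #|Y| = size xs.
  rewrite -cardX; apply/eqP; rewrite eqn_leq.
  by rewrite (tough_card_leq X Y esym) // (tough_card_leq Y X esym).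
have n1 : 1 < size xs.
  have : 2 < size xs + size xs.
    rewrite -{1}cardX -cardY; apply: leq_trans (leq_card_setU X Y).1.
    by rewrite cover cardsT.
  by case: (size xs) => [|[|]].
have [l [r lr]] : exists l r, forall y, y \in Y -> r y <= size xs /\
    forall k, k < size xs -> e y (nth x0 xs k) = (l y <= k < r y).
  (* Finite choice asks for a pair at every vertex; those outside [Y] get the dummy [(0, 0)]. *)
  have lr y : exists ab, y \in Y -> ab.2 <= size xs /\
      forall k, k < size xs -> e y (nth x0 xs k) = (ab.1 <= k < ab.2).
    have [yY|_] := boolP (y \in Y); last by exists (0, 0).
    have [s sxs sN] := conv y yY; have [a [b [bn ab]]] := infix_interval x0 s xs uxs sxs.
    by exists (a, b) => _; split=> // k lt_k; rewrite -ab // sN inE.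
  have [f fP] := fin_all_exists lr.
  by exists (fun y => (f y).1), (fun y => (f y).2).
have rep y k : y \in Y -> k < size xs -> e y (nth x0 xs k) = (l y <= k < r y).
  by move=> yY lt_k; have [_ ->] := lr y yY.
apply: (sparse_hamiltonian e x0 xs l r Y) => //.
- by rewrite (eq_disjoint xsX).
- by move=> v; rewrite xsX.
- by move=> y /lr[].
- by move=> a b; exact: (tough_sparse e x0 xs l r X Y).
Qed.
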